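(* There exists a skew left brace $(G, \cdot, \circ)$ such that the group $(G, \cdot)$ is finitely generated, but the group $(G, \circ)$ is not finitely generated.
   Context: A skew left brace is a triple $(G, \cdot, \circ)$ where $(G,\cdot)$ and $(G,\circ)$ are groups and $g_1 \circ (g_2 \cdot g_3) = (g_1 \circ g_2)\cdot g_1^{-1} \cdot (g_1 \circ g_3)$ for all $g_1,g_2,g_3 \in G$, where $g_1^{-1}$ is the inverse in $(G,\cdot)$. *)

(* Defs.v *)
From HB Require Import structures.
From mathcomp Require Import all_boot.
From mathcomp Require Import classical_sets cardinality.

Set Implicit Arguments.
Unset Strict Implicit.
Unset Printing Implicit Defensive.

Local Open Scope group_scope.

(* The underlying groupType is (G, .), written multiplicatively with 1, _ * _
   and _^-1; the operations circ, circ1 and circV are those of (G, o).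
   No relation between circ1 and 1 is assumed. *)
HB.mixin Record Group_isSkewLeftBrace G of Group G := {
  circ : G -> G -> G;
  circ1 : G;
  circV : G -> G;
  circA : associative circ;
  circ1g : left_id circ1 circ;
  circg1 : right_id circ1 circ;
  circVg : left_inverse circ1 circV circ;
  circgV : right_inverse circ1 circV circ;
  circM : forall x y z : G, circ x (y * z) = circ x y * x^-1 * circ x z
}.

#[short(type="skewLeftBraceType")]
HB.structure Definition SkewLeftBrace :=
  {G of Group G & Group_isSkewLeftBrace G}.

(* An alias of the carrier of G whose canonical groupType is (G, o), so that
   notions defined for a groupType apply to either group of the brace. *)
Definition circle_group (G : skewLeftBraceType) : Type := G.

HB.instance Definition _ (G : skewLeftBraceType) :=
  Choice.copy (circle_group G) G.
HB.instance Definition _ (G : skewLeftBraceType) :=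
  isGroup.Build (circle_group G)
    (@circA G) (@circ1g G) (@circg1 G) (@circVg G) (@circgV G).

Definition is_subgroup (G : groupType) (H : set G) : Prop :=
  [/\ H 1, forall x y, H x -> H y -> H (x * y) & forall x, H x -> H x^-1].

Definition finitely_generated (G : groupType) : Prop :=
  exists2 S : set G, finite_set S & smallest (@is_subgroup G) S = [set: G]%classic.

(* Main.v *)
(* For a semidirect product A ><| B, the direct-product law on the same carrier
   makes it a skew left brace.  Take the Baumslag-Solitar group Z[1/2] ><| Z,
   where k acts as multiplication by 2^k: it is generated by (1, 0) and (0, 1),
   because m / 2^n is a conjugate of the integer m.  The direct product
   Z[1/2] x Z is the union of the increasing chain of proper subgroups
   2^-n Z x Z, hence is not finitely generated. *)
Require Import Defs.
From HB Require Import structures.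
From mathcomp Require Import all_boot all_order all_algebra.
From mathcomp Require Import boolp classical_sets cardinality.

Set Implicit Arguments.
Unset Strict Implicit.
Unset Printing Implicit Defensive.

Import GRing.Theory Num.Theory.
Local Open Scope ring_scope.

(** This is the subgroup 2^-n Z of the rationals; the chain grows with [n] and its union is
    Z[1/2]. *)
Definition dyadic_level (n : nat) (a : rat) : Prop := 2 ^+ n * a \is a Num.int.

Lemma dyadic_levelW m n a : (m <= n)%N -> dyadic_level m a -> dyadic_level n a.
Proof.
move=> /subnK <- ma; rewrite /dyadic_level exprD -mulrA.
by rewrite rpredM // rpredX.
Qed.

Lemma dyadic_levelB n a b :
  dyadic_level n a -> dyadic_level n b -> dyadic_level n (a - b).
Proof. by move=> na nb; rewrite /dyadic_level mulrBr rpredB. Qed.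

(** The existential is made boolean classically, so that Z[1/2] becomes a subtype inheriting
    addition from [rat]. *)
Definition is_dyadic : {pred rat} := fun a => `[< exists n, dyadic_level n a >].

Fact is_dyadic_zmod_closed : zmod_closed is_dyadic.
Proof.
split=> [|a b /asboolP[m ma] /asboolP[n nb]]; apply/asboolP.
  by exists 0%N; rewrite /dyadic_level mulr0.
exists (maxn m n); apply: dyadic_levelB.
  exact: dyadic_levelW (leq_maxl m n) ma.
exact: dyadic_levelW (leq_maxr m n) nb.
Qed.
HB.instance Definition _ :=
  GRing.isZmodClosed.Build rat is_dyadic is_dyadic_zmod_closed.

Record dyadic := Dyadic { dyadic_val :> rat; dyadic_valP : dyadic_val \in is_dyadic }.
HB.instance Definition _ := [isSub for dyadic_val].
HB.instance Definition _ := [Choice of dyadic by <:].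
HB.instance Definition _ := [SubChoice_isSubZmodule of dyadic by <:].

Lemma is_dyadic_level n a : dyadic_level n a -> a \in is_dyadic.
Proof. by move=> na; apply/asboolP; exists n. Qed.

Lemma is_dyadic_scale (k : int) (a : dyadic) : 2 ^ k * dyadic_val a \in is_dyadic.
Proof.
have /asboolP[n na] := dyadic_valP a.
(* A nonnegative exponent keeps the level [n]; [Negz k] is -(k+1), so it raises the level by
   [k.+1]. *)
case: k => k; first apply: (@is_dyadic_level n); last apply: (@is_dyadic_level (k.+1 + n)).
  by rewrite /dyadic_level mulrCA rpredM // rpredX.
by rewrite /dyadic_level NegzE -exprnN exprD mulrACA divff ?mul1r // expf_neq0.
Qed.

Definition scale2 (k : int) (a : dyadic) : dyadic := Dyadic (is_dyadic_scale k a).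

Lemma scale2D k : {morph scale2 k : a b / a + b}.
Proof. by move=> a b; apply: val_inj; rewrite /= mulrDr. Qed.

Lemma scale2N k : {morph scale2 k : a / - a}.
Proof. by move=> a; apply: val_inj; rewrite /= mulrN. Qed.

Lemma scale2_0 k : scale2 k 0 = 0.
Proof. by apply: val_inj; rewrite /= mulr0. Qed.

Lemma scale20 a : scale2 0 a = a.
Proof. by apply: val_inj; rewrite /= expr0z mul1r. Qed.

Lemma scale2_scale2 k l a : scale2 k (scale2 l a) = scale2 (k + l) a.
Proof. by apply: val_inj; rewrite /= mulrA -expfzDr. Qed.

(** Carrier of BS(1,2) = < a, t | t a t^-1 = a^2 >, with a = (1, 0) and t = (0, 1). *)
Definition BS12 : Type := (dyadic * int)%type.
HB.instance Definition _ := Choice.copy BS12 (dyadic * int)%type.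

Definition BS12_mul (x y : BS12) : BS12 := (x.1 + scale2 x.2 y.1, x.2 + y.2).
Definition BS12_inv (x : BS12) : BS12 := (- scale2 (- x.2) x.1, - x.2).
Definition BS12_one : BS12 := (0, 0).

Fact BS12_mulA : associative BS12_mul.
Proof.
by move=> x y z; rewrite /BS12_mul /= scale2D scale2_scale2 !addrA.
Qed.

Fact BS12_mul1 : left_id BS12_one BS12_mul.
Proof. by move=> [a k]; rewrite /BS12_mul /= scale20 !add0r. Qed.

Fact BS12_mulr1 : right_id BS12_one BS12_mul.
Proof. by move=> [a k]; rewrite /BS12_mul /= scale2_0 !addr0. Qed.

Fact BS12_mulV : left_inverse BS12_one BS12_inv BS12_mul.
Proof. by move=> [a k]; rewrite /BS12_mul /= !addNr. Qed.

Fact BS12_mulrV : right_inverse BS12_one BS12_inv BS12_mul.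
Proof.
by move=> [a k]; rewrite /BS12_mul /= scale2N scale2_scale2 !addrN scale20 addrN.
Qed.

HB.instance Definition _ := isGroup.Build BS12
  BS12_mulA BS12_mul1 BS12_mulr1 BS12_mulV BS12_mulrV.

Lemma BS12_mulE (x y : BS12) : (x * y)%g = (x.1 + scale2 x.2 y.1, x.2 + y.2).
Proof. by []. Qed.

Lemma BS12_invE (x : BS12) : (x^-1)%g = (- scale2 (- x.2) x.1, - x.2).
Proof. by []. Qed.

Definition BS12_circ (x y : BS12) : BS12 := (x.1 + y.1, x.2 + y.2).
Definition BS12_circV (x : BS12) : BS12 := (- x.1, - x.2).

Fact BS12_circA : associative BS12_circ.
Proof. by move=> x y z; rewrite /BS12_circ /= !addrA. Qed.

Fact BS12_circ1 : left_id BS12_one BS12_circ.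
Proof. by move=> [a k]; rewrite /BS12_circ /= !add0r. Qed.

Fact BS12_circr1 : right_id BS12_one BS12_circ.
Proof. by move=> [a k]; rewrite /BS12_circ /= !addr0. Qed.

Fact BS12_circVl : left_inverse BS12_one BS12_circV BS12_circ.
Proof. by move=> [a k]; rewrite /BS12_circ /= !addNr. Qed.

Fact BS12_circVr : right_inverse BS12_one BS12_circV BS12_circ.
Proof. by move=> [a k]; rewrite /BS12_circ /= !addrN. Qed.

Fact BS12_circM (x y z : BS12) :
  BS12_circ x (y * z)%g = (BS12_circ x y * x^-1 * BS12_circ x z)%g.
Proof.
case: x y z => [a k] [b l] [c m].
rewrite /BS12_circ !BS12_mulE BS12_invE /=.
(* The product of the first two factors on the right is (a + b - 2^l a, l). Multiplying by (a + c, k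
   + m) adds 2^l (a + c), and the terms 2^l a cancel. *)
have -> : k + l - k = l by rewrite addrAC subrr add0r.
rewrite scale2N scale2_scale2 scale2D.
have -> : k + l - k = l by rewrite addrAC subrr add0r.
by congr pair; [rewrite -!addrA (addrA (- _)) addNr add0r | rewrite addrCA].
Qed.

HB.instance Definition _ := Group_isSkewLeftBrace.Build BS12
  BS12_circA BS12_circ1 BS12_circr1 BS12_circVl BS12_circVr BS12_circM.

Fact is_dyadic1 : 1 \in is_dyadic.
Proof. by apply: (@is_dyadic_level 0); rewrite /dyadic_level mulr1. Qed.

Definition dyadic1 : dyadic := Dyadic is_dyadic1.

Lemma dyadic_val_int m : dyadic_val (dyadic1 *~ m) = m%:~R.
Proof. exact: (raddfMz (val : dyadic -> rat)). Qed.

(** Induction covers the naturals and inverses cover the negatives. It serves for both cyclic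
    subgroups, [l] to (0, l) and [m] to (m, 0). *)
Lemma subgroup_int_powers (G : groupType) (H : set G) (f : int -> G) :
  is_subgroup H -> f 0 = 1%g -> {morph f : k l / k + l >-> (k * l)%g} ->
  H (f 1) -> forall k, H (f k).
Proof.
move=> [H1 HM HV] f0 fD Hf1.
have Hnat n : H (f n%:Z) by elim: n => [|n IHn]; rewrite ?f0 // intS fD; apply: HM.
case=> n //; rewrite NegzE.
suff -> : f (- n.+1%:Z) = (f n.+1%:Z)^-1%g by apply: HV.
by apply/eqP; rewrite -mulg_eq1 -fD addNr f0.
Qed.

Lemma BS12_finitely_generated : finitely_generated (BS12 : groupType).
Proof.
exists [set (dyadic1, 0); (0, 1)]%classic; first exact: finite_set2.
apply/seteqP; split=> // -[a k] _ H [Hgrp sub].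
have [_ HM _] := Hgrp.
have Hk l : H (0, l).
  apply: (subgroup_int_powers (f := fun l => (0, l) : BS12) Hgrp) => //.
    by move=> i j; rewrite !BS12_mulE /= scale2_0 addr0.
  by apply: sub; right.
have Hm m : H (dyadic1 *~ m, 0).
  apply: (subgroup_int_powers (f := fun m => (dyadic1 *~ m, 0) : BS12) Hgrp) => //.
    by move=> i j; rewrite !BS12_mulE /= scale20 mulrzDr addr0.
  by apply: sub; left.
have /asboolP[n /intrP[m na]] := dyadic_valP a.
(* With m = 2^n a, the factor (0, -n) scales m down to a, and the last factor corrects the second
   coordinate from -n to k. *)
suff -> : (a, k) = (((0%R, - n%:Z) : BS12) * ((dyadic1 *~ m, 0%R) : BS12)
                  * ((0%R, (n%:Z + k)%R) : BS12))%g.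
  by apply: (HM) => //; apply: HM.
rewrite !BS12_mulE /= scale2_0 !addr0 add0r addKr; congr pair.
apply: val_inj; rewrite /= dyadic_val_int -na -exprnN mulKf //.
by rewrite expf_neq0.
Qed.

(** Typed over [circle_group] so that closure refers to the direct-product law; the semidirect law
    does not preserve this set, since (0, -1) halves the first coordinate. *)
Definition BS12_level (n : nat) : set (circle_group BS12) :=
  [set x : BS12 | dyadic_level n x.1]%classic.

Lemma BS12_level_subgroup n : is_subgroup (BS12_level n).
Proof.
have N a : dyadic_level n a -> dyadic_level n (- a).
  by rewrite /dyadic_level mulrN rpredN.
split=> [|x y nx ny|x nx]; last exact: N.
  by rewrite /BS12_level /= /dyadic_level mulr0.
rewrite /BS12_level /= -[X in _ + X]opprK; apply: dyadic_levelB => //; exact: N.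
Qed.

(** The levels form a chain, so the maximum of finitely many levels serves all the elements. *)
Lemma dyadic_common_level (s : seq BS12) :
  exists n, forall x, x \in s -> dyadic_level n x.1.
Proof.
elim: s => [|x s [n ns]]; first by exists 0%N.
have /asboolP[m mx] := dyadic_valP x.1.
exists (maxn m n) => y; rewrite inE => /predU1P[-> | /ns ny].
  exact: dyadic_levelW (leq_maxl m n) mx.
exact: dyadic_levelW (leq_maxr m n) ny.
Qed.

Lemma dyadic_level_proper n : exists a : dyadic, ~ dyadic_level n a.
Proof.
(* The witness is 2^-(n+1): multiplied by 2^n it gives 1/2, not an integer. *)
exists (scale2 (- n.+1%:Z) dyadic1).
by rewrite /dyadic_level /= mulr1 -exprnN exprS invfM mulrCA divff ?expf_neq0.
Qed.

Lemma BS12_circle_not_finitely_generated :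
  ~ finitely_generated (circle_group BS12).
Proof.
move=> [S /finite_seqP[s ->] gen].
have [n ns] := dyadic_common_level s.
have [a na] := dyadic_level_proper n.
have : smallest (@is_subgroup (circle_group BS12)) [set` s]%classic (a, 0).
  by rewrite gen.
(* [smallest] is an intersection, so (a, 0) would lie in the level-[n] subgroup, which contains all
   the generators. *)
by move=> /(_ (BS12_level n)) H; apply/na/H; split; first exact: BS12_level_subgroup.
Qed.

Theorem proposition5p10 :
  exists G : skewLeftBraceType,
    finitely_generated G /\ ~ finitely_generated (circle_group G).
Proof.
exists BS12; split; first exact: BS12_finitely_generated.
exact: BS12_circle_not_finitely_generated.
Qed.
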